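(* Let $\mathcal{A}$ be a homogeneous amorphic table algebra and let $\widehat{\mathcal{A}}$ be the dual $C$-algebra of $\mathcal{A}$. Then $\widehat{\mathcal{A}}$ is also a homogeneous amorphic table algebra. Moreover, if $\mathcal{A}\in\mathcal{A}_\varepsilon(\nu,d)$ for some $\varepsilon,\nu,d$, then $\widehat{\mathcal{A}}\in\mathcal{A}_\varepsilon(\nu,d)$. In particular, the table algebras $\mathcal{A}$ and $\widehat{\mathcal{A}}$ are isomorphic.
   Context: $C$-algebra: a pair $\mathcal{A}=(A,\mathcal{R})$ where $A$ is a finite-dimensional associative algebra over $\mathbb{C}$ with unit $e$ and a semilinear involutive anti-automorphism $*$, and $\mathcal{R}$ is a linear basis of $A$ with structure constants defined by $r\cdot s=\sum_{t\in\mathcal{R}}c_{r,s}^t t$ ($r,s\in\mathcal{R}$), such that: (C1) $e\in\mathcal{R}$ and $r^*\in\mathcal{R}$ for all $r\in\mathcal{R}$; (C2) $c_{r,s}^t\in\mathbb{R}$ for all $r,s,t\in\mathcal{R}$; (C3) for all $r,s\in\mathcal{R}$, $c_{r,s}^e=d_r\delta_{r^*,s}$ where $d_r>0$ and $\delta$ is the Kronecker symbol; (C4) the linear functional on $A$ defined by $r\mapsto d_r$ ($r\in\mathcal{R}$) is a one-dimensional $*$-representation of $A$. A table algebra is a $C$-algebra all of whose structure constants are nonnegative. A $C$-algebra is homogeneous if $d_r$ does not depend on $r\in\mathcal{R}\setminus\{e\}$. An isomorphism from $(A,\mathcal{R})$ to $(A',\mathcal{R}')$ is a $*$-algebra isomorphism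 $\varphi:A\to A'$ with $\varphi(\mathcal{R})=\mathcal{R}'$. Fusion: for a partition $\pi$ of $\mathcal{R}$ with $\{e\}\in\pi$, the $\pi$-fusion of $\mathcal{A}$ is the pair $\mathcal{A}_\pi=(A_\pi,\mathcal{R}_\pi)$ where $\mathcal{R}_\pi=\{\sum_{r\in R}r:\ R\in\pi\}$ and $A_\pi$ is the linear span of $\mathcal{R}_\pi$; it is a $C$-algebra (with the inherited operations) iff $A_\pi$ is a $*$-subalgebra of $A$. Amorphic: $\mathcal{A}$ is amorphic if for every partition $\pi$ of $\mathcal{R}$ with $\{e\}\in\pi$ the $\pi$-fusion $\mathcal{A}_\pi$ is a $C$-algebra. (Amorphic $C$-algebras are commutative.) Dual $C$-algebra (Bannai–Ito) of a commutative $C$-algebra $\mathcal{A}=(A,\mathcal{R})$: let $n=\sum_{r\in\mathcal{R}}d_r$. The algebra $A$ is semisimple; let $E_0,\dots,E_{\nu-1}$ be its primitive idempotents, $\nu=|\mathcal{R}|$, with $E_0=\frac1n\sum_{r\in\mathcal{R}}r$. Then $\widehat{\mathcal{A}}=(\widehat A,\widehat{\mathcal{R}})$, where $\widehat A$ is the vector space $A$ with the multiplication $\circ$ determined by $r\circ s=\delta_{r,s}r$ for $r,s\in\mathcal{R}$, with the semilinear involution fixing each $r\in\mathcal{R}$ (i.e. $\sum a_rr\mapsto\sum\overline{a_r}\,r$), with unit $\sum_{r\in\mathcal{R}}r=nE_0$, and with distinguished basis $\widehat{\mathcal{R}}=\{nE_i:\ i=0,\dots,\nu-1\}$. This is a $C$-algebra,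 in which the degree of $nE_i$ is the coefficient of $e$ in the expansion of $nE_i$ in the basis $\mathcal{R}$. The algebra $\mathcal{A}_\varepsilon(\mathcal{R},D)$: let $D$ be a finite multiset of at least four positive real numbers with $1\in D$, and $\varepsilon\in\{-1,+1\}$. Let $\mathcal{R}$ be a finite set with a distinguished element $e$ and $r\mapsto d_r$ a bijection from $\mathcal{R}$ to the multiset $D$ with $d_e=1$. Let $A$ be the complex vector space with basis $\mathcal{R}$, and let $*$ be the semilinear map on $A$ fixing every element of $\mathcal{R}$. Put $n=\sum_{r\in\mathcal{R}}d_r$, $d'_r=n-1-d_r$, $\mathcal{R}^\#=\mathcal{R}\setminus\{e\}$. Define $c_{r,s}^t$ by: $c_{r,s}^e=d_r\delta_{r,s}$; for $r,s,t\in\mathcal{R}^\#$, $c_{r,s}^t=\frac{d_rd_s}{(\sqrt n+\varepsilon)^2}$ if $r,s,t$ are pairwise distinct, $c_{r,r}^t=\frac{d_r}{2}\bigl(1+\frac{d_r-d'_r}{(\sqrt n+\varepsilon)^2}\bigr)$ if $r\neq t$, and $c_{r,r}^r=-\frac{d'_r}{2}\bigl(1+\frac{d_r-d'_r}{(\sqrt n+\varepsilon)^2}\bigr)+d_r-1$; in all remaining cases by the equalities $d_tc_{r,s}^{t}=d_rc_{s,t}^{r}=d_sc_{t,r}^{s}$, which means $c_{e,r}^t=c_{r,e}^t=\delta_{r,t}$, and $c_{r,s}^r=c_{s,r}^r=\frac{d_s}{d_r}c_{r,r}^s$ for distinct $r,s\in\mathcal{R}^\#$. The multiplication on $A$ is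 the bilinear one with $r\cdot s=\sum_{t\in\mathcal{R}}c_{r,s}^tt$, and $\mathcal{A}_\varepsilon(\mathcal{R},D)=(A,\mathcal{R})$. The class $\mathcal{A}_\varepsilon(\nu,d)$ consists of all $C$-algebras (up to isomorphism) $\mathcal{A}_\varepsilon(\mathcal{R},D)$ with $|\mathcal{R}|=\nu$ and $D=\{1,d,\ldots,d\}$, where $d$ is a positive real number occurring $\nu-1$ times.
   Formalization: Algebras of dimension exactly 3 are excluded: there the claim fails in general, e.g. rr=4e+2r+s, rs=r+3s, ss=4e+3r is a homogeneous amorphic table algebra whose dual has unequal degrees 4±8/√13; all other dimensions are covered. *)

(* Defs.v *)
From HB Require Import structures.
From mathcomp Require Import all_boot all_order all_algebra.
From mathcomp Require Import finmap complex.
From mathcomp Require Import classical_sets cardinality reals.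
Set Implicit Arguments.
Unset Strict Implicit.
Unset Printing Implicit Defensive.
Import Order.TTheory GRing.Theory Num.Theory.
Local Open Scope fset_scope.
Local Open Scope ring_scope.

(* Raw data of a pair (A, basis) over the complex numbers R[i].  The product is
   a field of the record rather than a canonical ring structure because the dual
   algebra carries a second product on the same vector space, and because some
   algebras below are given by structure constants only.  The axioms are
   collected in [is_Calgebra]. *)
Record algData (R : realType) := AlgData {
  carrier :> vectType R[i];
  amul : carrier -> carrier -> carrier;
  aone : carrier;
  astar : carrier -> carrier;
  basis : {fset carrier} }.

Arguments amul {R a}.
Arguments astar {R a}.

Section CAlgebras.
Variable R : realType.
Implicit Types X Y : algData R.

(* The coefficient of t in the expansion of v in the basis of X (0 if t is not
   a basis element). *)
Definition coef X (v t : X) : R[i] :=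
  \sum_(i < size (basis X) | (basis X)`_i == t) coord (in_tuple (basis X)) i v.

(* The structure constant c_{r,s}^t. *)
Definition sconst X (r s t : X) : R[i] := coef (amul r s) t.

(* d_r, read off from the equality c_{r,r*}^e = d_r of axiom (C3). *)
Definition degree X (r : X) : R[i] := sconst r (astar r) (aone X).

Definition degree_fun X (v : X) : R[i] :=
  \sum_(r <- basis X) coef v r * degree r.

Definition is_star_algebra X : Prop :=
  [/\ (forall u : X, linear (amul u)) /\ (forall u : X, linear (amul^~ u)),
      associative (amul : X -> X -> X),
      left_id (aone X) (amul : X -> X -> X) /\ right_id (aone X) (amul : X -> X -> X),
      involutive (astar : X -> X) /\
      (forall (a : R[i]) (u v : X),
         astar (a *: u + v) = a^* *: astar u + astar v)
    & forall u v : X, astar (amul u v) = amul (astar v) (astar u)].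

Definition C1 X : Prop :=
  aone X \in basis X /\ {in basis X, forall r, astar r \in basis X}.

Definition C2 X : Prop :=
  {in basis X & &, forall r s t, sconst r s t \is Num.real}.

Definition C3 X : Prop :=
  {in basis X, forall r, 0 < degree r} /\
  {in basis X &, forall r s,
     sconst r s (aone X) = degree r * (astar r == s)%:R}.

Definition C4 X : Prop :=
  [/\ degree_fun (aone X) = 1,
      forall u v : X, degree_fun (amul u v) = degree_fun u * degree_fun v
    & forall u : X, degree_fun (astar u) = (degree_fun u)^*].

Definition is_Calgebra X : Prop :=
  [/\ is_star_algebra X, basis_of fullv (basis X), C1 X, C2 X & C3 X /\ C4 X].

Definition is_table_algebra X : Prop :=
  is_Calgebra X /\ {in basis X & &, forall r s t, 0 <= sconst r s t}.

Definition homogeneous X : Prop :=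
  {in basis X `\ aone X &, forall r s, degree r = degree s}.

Definition isomorphic X Y : Prop :=
  exists f : {linear X -> Y},
    [/\ bijective f,
        forall u v : X, f (amul u v) = amul (f u) (f v),
        f (aone X) = aone Y,
        forall u : X, f (astar u) = astar (f u)
      & [fset f r | r in basis X] = basis Y].

Section Fusion.
Variables (X : algData R) (pi : {set {set basis X}}).

Definition fusion_basis : {fset X} :=
  [fset \sum_(r in B) val r | B : {set basis X} in pi].

Definition fusion_space : {vspace X} := <<fusion_basis>>%VS.

(* The inherited operations are corestricted to the span by [vsproj]; they are
   the genuine restrictions when the span is closed under the operations of X,
   which [amorphic] demands separately. *)
Definition fusion : algData R :=
  @AlgData R (subvs_of fusion_space)
    (fun u v => vsproj fusion_space (amul (vsval u) (vsval v)))
    (vsproj fusion_space (aone X))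
    (fun u => vsproj fusion_space (astar (vsval u)))
    [fset vsproj fusion_space x | x in fusion_basis].

End Fusion.

Definition is_star_subalgebra X (U : {vspace X}) : Prop :=
  [/\ aone X \in U,
      {in U &, forall u v, amul u v \in U}
    & {in U, forall u, astar u \in U}].

Definition amorphic X : Prop :=
  forall pi : {set {set basis X}},
    finset.partition pi [set: basis X] ->
    [set r : basis X | val r == aone X] \in pi ->
    is_star_subalgebra (fusion_space pi) /\ is_Calgebra (fusion pi).

Definition idempotent_elt X (E : X) : Prop := amul E E = E.

Definition primitive_idempotent X (E : X) : Prop :=
  [/\ E != 0, idempotent_elt E
    & forall F G : X, idempotent_elt F -> idempotent_elt G ->
        amul F G = 0 -> amul G F = 0 -> E = F + G -> F = 0 \/ G = 0].

Definition total_degree X : R[i] := \sum_(r <- basis X) degree r.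

(* [fset_set] turns a finite set into a {fset _} (and an infinite one into the
   empty set). *)
Definition dual X : algData R :=
  @AlgData R X
    (fun u v => \sum_(r <- basis X) (coef u r * coef v r) *: r)
    (\sum_(r <- basis X) r)
    (fun u => \sum_(r <- basis X) (coef u r)^* *: r)
    (fset_set (fun x : X =>
       exists2 E : X, primitive_idempotent E & x = total_degree X *: E)).

Section Aeps.
Variables (eps : R) (I : finType) (e : I) (d : I -> R).

Definition Aeps_order : R := \sum_r d r.

Definition Aeps_codeg (r : I) : R := Aeps_order - 1 - d r.

Definition Aeps_den : R := (Num.sqrt Aeps_order + eps) ^+ 2.

Definition Aeps_factor (r : I) : R := 1 + (d r - Aeps_codeg r) / Aeps_den.

(* c_{r,r}^t for r, t distinct and both different from e. *)
Definition Aeps_sqcoef (r : I) : R := d r / 2 * Aeps_factor r.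

Definition Aeps_const (r s t : I) : R :=
  if t == e then d r * (r == s)%:R
  else if r == e then (s == t)%:R
  else if s == e then (r == t)%:R
  else if r == s then
    if t == r then - (Aeps_codeg r / 2 * Aeps_factor r) + d r - 1
    else Aeps_sqcoef r
  else if t == r then d s / d r * Aeps_sqcoef r
  else if t == s then d r / d s * Aeps_sqcoef s
  else d r * d s / Aeps_den.

(* The vector space with basis I is {ffun I -> R[i]}, and r : I is identified
   with the indicator function of r. *)
Definition Aeps_elt (r : I) : {ffun I -> R[i]^o} := [ffun t => (t == r)%:R].

Definition Aeps : algData R :=
  @AlgData R {ffun I -> R[i]^o}
    (fun u v => [ffun t => \sum_r \sum_s
       u r * v s * (real_complex R (Aeps_const r s t))])
    (Aeps_elt e)
    (fun u => [ffun t => (u t : R[i])^*])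
    [fset Aeps_elt r | r in I].

(* The conditions on the multiset D (a sequence up to permutation) and on the
   bijection r |-> d r from I to D. *)
Definition degree_labelling (D : seq R) : Prop :=
  [/\ (4 <= size D)%N, 1 \in D, all (fun x => 0 < x) D,
      perm_eq [seq d r | r <- enum I] D & d e = 1].

End Aeps.

Definition in_Aeps_class (eps : R) (nu : nat) (d : R) X : Prop :=
  (eps = 1 \/ eps = -1) /\ 0 < d /\
  exists (I : finType) (e : I) (dg : I -> R),
    [/\ #|I| = nu, degree_labelling e dg (1 :: nseq nu.-1 d),
        is_Calgebra X & isomorphic X (Aeps eps e dg)].

End CAlgebras.

(* Main.v *)
From HB Require Import structures.
Require Import Defs.
From mathcomp Require Import all_boot all_order all_algebra.
From mathcomp Require Import finmap complex reals.
From mathcomp Require classical_sets cardinality.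
From mathcomp Require Import ring.

Set Implicit Arguments.
Unset Strict Implicit.
Unset Printing Implicit Defensive.
Import Order.TTheory GRing.Theory Num.Theory.
Local Open Scope ring_scope.

(** Write e for the unit, J for the sum of the basis, m + 1 for the rank and d
    for the common degree of the basis elements r <> e.

    The structure constants.  In rank at least 4, fuse all basis elements other
    than e, r and s into one class: since the fusion is an algebra, r s has the
    same coefficient at every t outside {e, r, s}.  In the same way the star
    fixes the basis, so the algebra is commutative.  Equal degrees turn the
    identity d_t c_{rs}^t = d_r c_{st}^r into invariance of c_{rs}^t under all
    permutations of r, s, t, and counting degrees then leaves only two numbers,
    a = c_{rr}^s and p = c_{rs}^t.  Associativity yields p = (a - p)^2.  With
    q = a - p the whole algebra is determined by q and m:
      d = 2q + m q^2  and, for all r, s <> e,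
      r s = q (r + s) + q^2 (J - e) + [r = s] (w (q e - r) + q J),
    where w = 1 + m q, and the sum n of the degrees is w^2.  In ranks 1 and 2
    the same formulas hold, with q = 0 and q = sqrt (1 + d) - 1.  This is
    [self_dual_at]; see [homogeneous_amorphic_self_dual] and
    [rank_le2_self_dual].

    Self-duality.  Modulo J the formula says (r - q e)(s - q e) = 0 for r <> s.
    So, besides the degree, the algebra has one character for each t <> e: it
    sends t to q - w and every other r <> e to q.  Thus the characters are
    indexed by the basis itself, and the character table P is a symmetric matrix
    with P^2 = n.  The linear map with matrix P, [eigen_transform], turns the
    product into the entrywise product of coordinates because the rows of P are
    characters.  Its square is multiplication by n.  The basis elements are the
    primitive idempotents of the entrywise product, so the primitive idempotents
    E of the algebra are those for which P E is a basis element t, and for these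
    n E = P (P E) = P t.  Hence P maps the basis onto that of the dual and is an
    isomorphism from the algebra to its dual ([isomorphic_eigen_dual]).

    All the properties of the dual follow by transport along this isomorphism;
    for amorphicity, a partition is pulled back and the two fusions are shown to
    be isomorphic ([iso_amorphic]). *)

(** * Coordinates in the basis *)

Section Coefficients.
Variables (R : realType) (X : algData R).
Hypothesis basisX : basis_of fullv (basis X).
Implicit Types (u v r s t : X).

Lemma coef_linear (a : R[i]) u v t :
  coef (a *: u + v) t = a * coef u t + coef v t.
Proof.
by rewrite /coef mulr_sumr -big_split; apply: eq_bigr => i _; rewrite linearP.
Qed.

Lemma coef0 t : coef (0 : X) t = 0.
Proof. by rewrite /coef big1 => [|i _] //; rewrite linear0. Qed.

Lemma coefD u v t : coef (u + v) t = coef u t + coef v t.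
Proof. by rewrite -{1}[u]scale1r coef_linear mul1r. Qed.

Lemma coefZ (a : R[i]) u t : coef (a *: u) t = a * coef u t.
Proof. by rewrite -{1}[a *: u]addr0 coef_linear coef0 addr0. Qed.

Lemma coefN u t : coef (- u) t = - coef u t.
Proof. by rewrite -scaleN1r coefZ mulN1r. Qed.

Lemma coefB u v t : coef (u - v) t = coef u t - coef v t.
Proof. by rewrite coefD coefN. Qed.

Lemma coef_sum (I : Type) (s : seq I) (P : pred I) (F : I -> X) t :
  coef (\sum_(i <- s | P i) F i) t = \sum_(i <- s | P i) coef (F i) t.
Proof.
by apply: (big_morph (fun v => coef v t)) => [u v|]; [apply: coefD|apply: coef0].
Qed.

Lemma coef_nth (i : 'I_(size (basis X))) v :
  coef v (basis X)`_i = coord (in_tuple (basis X)) i v.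
Proof.
rewrite /coef (bigD1 i) //= big1 ?addr0 // => j /andP[/eqP Xji jNi].
case/negP: jNi; rewrite -val_eqE /= -(nth_uniq 0 _ _ (fset_uniq (basis X))) //.
exact/eqP.
Qed.

Lemma coef_notin v t : t \notin basis X -> coef v t = 0.
Proof.
move=> tN; rewrite /coef big_pred0 // => i; apply: contraNF tN => /eqP <-.
exact: mem_nth.
Qed.

Lemma coef_expand v : v = \sum_(r <- basis X) coef v r *: r.
Proof.
have vX : v \in <<in_tuple (basis X)>>%VS.
  by rewrite /= (span_basis basisX) memvf.
rewrite (big_nth 0) big_mkord [LHS](coord_span vX).
by apply: eq_bigr => i _; rewrite coef_nth.
Qed.

Lemma coef_comb (c : X -> R[i]) t : t \in basis X ->
  coef (\sum_(r <- basis X) c r *: r) t = c t.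
Proof.
move=> tX; rewrite -[t in LHS](nth_index 0 tX).
have it : (index t (basis X) < size (basis X))%N by rewrite index_mem.
rewrite (coef_nth (Ordinal it)) (big_nth 0) big_mkord.
rewrite (coord_sum_free (fun i => c (basis X)`_i)) ?(basis_free basisX) //=.
by rewrite nth_index.
Qed.

Lemma coef_basis r t : r \in basis X -> t \in basis X ->
  coef r t = (r == t)%:R.
Proof.
move=> rX tX; have {1}-> : r = \sum_(s <- basis X) (s == r)%:R *: s.
  rewrite (bigD1_seq r) ?fset_uniq //= eqxx scale1r big1 ?addr0 // => s.
  by move/negbTE->; rewrite scale0r.
by rewrite coef_comb // eq_sym.
Qed.

Lemma coef_inj u v : {in basis X, forall t, coef u t = coef v t} -> u = v.
Proof.
move=> uv; rewrite [u]coef_expand [v]coef_expand.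
by apply: eq_big_seq => t tX; rewrite uv.
Qed.

Lemma coef_one_basis_sum t : t \in basis X -> coef (\sum_(r <- basis X) r) t = 1.
Proof.
move=> tX; rewrite -[RHS](coef_comb (fun=> 1) tX).
by congr coef; apply: eq_bigr => r _; rewrite scale1r.
Qed.

Lemma basis_neq0 r : r \in basis X -> r != 0.
Proof.
move=> rX; apply/eqP => r0; have := coef_basis rX rX.
by rewrite {1}r0 coef0 eqxx => /esym/eqP; rewrite oner_eq0.
Qed.

End Coefficients.

(** * Invariance under isomorphism *)

Section Transport.
Variables (R : realType) (X Y : algData R) (f : {linear X -> Y}).
Hypotheses (f_bij : bijective f)
  (fM : forall u v : X, f (amul u v) = amul (f u) (f v))
  (f1 : f (aone X) = aone Y)
  (fS : forall u : X, f (astar u) = astar (f u))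
  (fB : [fset f r | r in basis X]%fset = basis Y).
Implicit Types (u v r s t : X).

Let f_inj : injective f := bij_inj f_bij.

Lemma iso_surj (P : Y -> Prop) : (forall u, P (f u)) -> forall y, P y.
Proof. by have [g _ gK] := f_bij => Pf y; rewrite -[y]gK. Qed.

Lemma iso_mem_basis r : (f r \in basis Y) = (r \in basis X).
Proof. by rewrite -fB mem_imfset. Qed.

Lemma iso_basisP (P : Y -> Prop) :
  {in basis X, forall r, P (f r)} -> {in basis Y, forall y, P y}.
Proof. by move=> Pf; apply: iso_surj => u; rewrite iso_mem_basis; apply: Pf. Qed.

Lemma iso_perm_basis : perm_eq (basis Y) [seq f r | r <- basis X].
Proof. by rewrite -fB; apply: enum_imfset => u v _ _; apply: f_inj. Qed.

Lemma iso_big_basis (V : nmodType) (F : Y -> V) :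
  \sum_(y <- basis Y) F y = \sum_(r <- basis X) F (f r).
Proof. by rewrite (perm_big _ iso_perm_basis) big_map. Qed.

Lemma iso_basis_of : basis_of fullv (basis X) -> basis_of fullv (basis Y).
Proof.
move=> basisX; rewrite (perm_basis _ iso_perm_basis).
have f_ker : (fullv :&: lker (linfun f) = 0)%VS.
  by apply/eqP; rewrite capfv; apply/lker0P => u v; rewrite !lfunE => /f_inj.
have := limg_basis_of f_ker basisX.
have -> : (linfun f @: fullv = fullv)%VS.
  apply/eqP; rewrite eqEsubv subvf /=; apply/subvP.
  by apply: iso_surj => u _; rewrite -(lfunE f) memv_img ?memvf.
by congr basis_of; apply: eq_map => u; rewrite lfunE.
Qed.

Lemma iso_coef (basisX : basis_of fullv (basis X)) v t :
  coef (f v) (f t) = coef v t.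
Proof.
have [tX|tN] := boolP (t \in basis X); last first.
  by rewrite !coef_notin ?iso_mem_basis.
rewrite {1}(coef_expand basisX v) linear_sum.
have [g fK _] := f_bij.
under eq_bigr => r _ do rewrite linearZ /= -{1}[r]fK.
rewrite -(iso_big_basis (fun y => coef v (g y) *: y)).
by rewrite (coef_comb (iso_basis_of basisX)) ?iso_mem_basis // fK.
Qed.

Lemma iso_sconst (basisX : basis_of fullv (basis X)) r s t :
  sconst (f r) (f s) (f t) = sconst r s t.
Proof. by rewrite /sconst -fM iso_coef. Qed.

Lemma iso_degree (basisX : basis_of fullv (basis X)) r :
  degree (f r) = degree r.
Proof. by rewrite /degree -fS -f1 iso_sconst. Qed.

Lemma iso_degree_fun (basisX : basis_of fullv (basis X)) v :
  degree_fun (f v) = degree_fun v.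
Proof.
rewrite /degree_fun iso_big_basis; apply: eq_bigr => r _.
by rewrite iso_coef // iso_degree.
Qed.

Lemma iso_star_algebra : is_star_algebra X -> is_star_algebra Y.
Proof.
case=> [[linl linr] mulA [mul1 mulr1] [starK star_lin] starM]; split.
- split; apply: iso_surj => u a; elim/iso_surj => v; elim/iso_surj => w.
    by rewrite -linearP -!fM linl linearP.
  by rewrite -linearP -!fM linr linearP.
- elim/iso_surj => u; elim/iso_surj => v; elim/iso_surj => w.
  by rewrite -!fM mulA.
- by split; elim/iso_surj => u; rewrite -f1 -fM ?mul1 ?mulr1.
- split; first by elim/iso_surj => u; rewrite -!fS starK.
  move=> a; elim/iso_surj => u; elim/iso_surj => v.
  by rewrite -linearP -!fS star_lin linearP.
- by elim/iso_surj => u; elim/iso_surj => v; rewrite -fM -!fS starM fM.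
Qed.

Lemma iso_Calgebra : is_Calgebra X -> is_Calgebra Y.
Proof.
case=> [starX bX [oneX starX'] C2X [[dpos C3X] [d1 dM dS]]].
split; [exact: iso_star_algebra|exact: iso_basis_of| | |split].
- split; first by rewrite -f1 iso_mem_basis.
  by apply: iso_basisP => r rX; rewrite -fS iso_mem_basis starX'.
- move=> y z t; elim/iso_surj: y => r; elim/iso_surj: z => s.
  elim/iso_surj: t => t; rewrite !iso_mem_basis iso_sconst //; exact: C2X.
- split; first by apply: iso_basisP => r rX; rewrite iso_degree ?dpos.
  move=> y z; elim/iso_surj: y => r; elim/iso_surj: z => s.
  rewrite !iso_mem_basis => rX sX.
  by rewrite -fS -f1 iso_sconst // iso_degree // (inj_eq f_inj) C3X.
- split; first by rewrite -f1 iso_degree_fun.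
    elim/iso_surj => u; elim/iso_surj => v.
    by rewrite -fM !iso_degree_fun.
  by elim/iso_surj => u; rewrite -fS !iso_degree_fun.
Qed.

Lemma iso_table_algebra : is_table_algebra X -> is_table_algebra Y.
Proof.
case=> CX pos; split; first exact: iso_Calgebra.
have [_ bX _ _ _] := CX.
move=> y z t; elim/iso_surj: y => r; elim/iso_surj: z => s.
elim/iso_surj: t => t; rewrite !iso_mem_basis iso_sconst //; exact: pos.
Qed.

Lemma iso_homogeneous (basisX : basis_of fullv (basis X)) :
  homogeneous X -> homogeneous Y.
Proof.
move=> homX y z; elim/iso_surj: y => r; elim/iso_surj: z => s.
rewrite !in_fsetD1 !iso_mem_basis -f1 !(inj_eq f_inj) => rX sX.
by rewrite !iso_degree //; apply: homX; rewrite in_fsetD1.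
Qed.

End Transport.

Lemma isomorphic_sym (R : realType) (X Y : algData R) :
  isomorphic X Y -> isomorphic Y X.
Proof.
case=> f [f_bij fM f1 fS fB].
have f_inj := bij_inj f_bij.
have ker0 : lker (linfun f) == 0%VS.
  by apply/lker0P => u v; rewrite !lfunE => /f_inj.
pose g : {linear Y -> X} := (linfun f)^-1%VF.
have fK : cancel f g by move=> u; rewrite -(lfunE f); apply: (lker0_lfunK ker0).
have gK : cancel g f by apply: (iso_surj f_bij) => u; rewrite fK.
exists g; split; first by exists f.
- by apply: (iso_surj f_bij) => u; apply: (iso_surj f_bij) => v; rewrite -fM !fK.
- by rewrite -f1 fK.
- by apply: (iso_surj f_bij) => u; rewrite -fS !fK.
- rewrite -fB -imfset_comp -[RHS]imfset_id.
  by apply: eq_imfset => // u; rewrite /= fK.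
Qed.

Lemma isomorphic_trans (R : realType) (X Y Z : algData R) :
  isomorphic X Y -> isomorphic Y Z -> isomorphic X Z.
Proof.
case=> f [f_bij fM f1 fS fB] [g [g_bij gM g1 gS gB]].
exists (g \o f : {linear X -> Z}); split=> /=.
- exact: bij_comp.
- by move=> u v; rewrite fM gM.
- by rewrite f1 g1.
- by move=> u; rewrite fS gS.
- by rewrite imfset_comp fB gB.
Qed.

(** A partition of the basis of Y is pulled back to the basis of X.  The fusion
    spaces then correspond under f, so f restricts to an isomorphism between the
    two fusions. *)
Lemma iso_amorphic (R : realType) (X Y : algData R) :
  isomorphic X Y -> amorphic X -> amorphic Y.
Proof.
case=> f [f_bij fM f1 fS fB] amoX pi pi_part pi_one.
have f_inj := bij_inj f_bij; have [g fK gK] := f_bij.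
have gX (y : basis Y) : g (val y) \in basis X.
  by rewrite -(iso_mem_basis f_bij fB) gK; apply: valP.
pose k (y : basis Y) : basis X := [` gX y]%fset.
have fk y : f (val (k y)) = val y by apply: gK.
have k_inj : injective k.
  by move=> y z /(congr1 (f \o val)) /=; rewrite !gK; apply: val_inj.
have k_surj x : exists y, x = k y.
  have fx : f (val x) \in basis Y by rewrite (iso_mem_basis f_bij fB) (valP x).
  by exists [` fx]%fset; apply: val_inj; rewrite /= fK.
pose pi' := [set k @: (B : {set basis Y}) | B in pi].
have pi'_part : finset.partition pi' [set: basis X].
  have <- : k @: [set: basis Y] = [set: basis X].
    by apply/setP => x; have [y ->] := k_surj x; rewrite !inE imset_f ?inE.
  by rewrite imset_partition.
have pi'_one : [set r : basis X | val r == aone X] \in pi'.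
  apply/imsetP; exists [set y : basis Y | val y == aone Y] => //.
  apply/setP => x; have [y ->] := k_surj x.
  by rewrite mem_imset // !inE -f1 -fk (inj_eq f_inj).
have [subX CX] := amoX _ pi'_part pi'_one.
have fbE : fusion_basis pi = [fset f x | x in fusion_basis pi']%fset.
  have kB (B : {set basis Y}) : \sum_(y in B) val y = f (\sum_(x in k @: B) val x).
    rewrite big_imset /= => [|y z _ _]; last exact: k_inj.
    by rewrite linear_sum; apply: eq_bigr => y _; rewrite fk.
  apply/fsetP => v; apply/imfsetP/imfsetP => /= [[B Bpi ->]|].
    exists (\sum_(x in k @: B) val x); last exact: kB.
    by apply/imfsetP; exists (k @: B); rewrite //= imset_f.
  case=> _ /imfsetP[/= _ /imsetP[B Bpi ->] ->] ->.
  by exists B; rewrite // kB.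
set U' := fusion_space pi' in subX CX *.
have fU v : (f v \in fusion_space pi) = (v \in U').
  have -> : fusion_space pi = (linfun f @: U')%VS.
    rewrite limg_span; apply: eq_span => w; rewrite fbE.
    apply/imfsetP/mapP => /= -[x xU ->]; exists x; rewrite ?lfunE //.
  rewrite -lfunE; apply/memv_imgP/idP => [[u uU]|vU]; last by exists v.
  by rewrite !lfunE => /f_inj ->.
have [oneU mulU starU] := subX.
split.
  split; first by rewrite -f1 fU.
    move=> y z; elim/(iso_surj f_bij): y => u; elim/(iso_surj f_bij): z => v.
    by rewrite -fM !fU; apply: mulU.
  by move=> y; elim/(iso_surj f_bij): y => u; rewrite -fS !fU; apply: starU.
pose h : {linear fusion pi' -> fusion pi} :=
  vsproj (fusion_space pi) \o f \o (@vsval _ _ U').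
have hE u : vsval (h u) = f (vsval u) by rewrite /= vsprojK // fU subvsP.
have vE u : u \in U' -> vsval (h (vsproj U' u)) = f u.
  by move=> uU; rewrite hE vsprojK.
apply: (@iso_Calgebra _ (fusion pi') (fusion pi) h) => //.
- exists (vsproj U' \o g \o (@vsval _ _ (fusion_space pi))) => u.
    by apply: val_inj; rewrite /= vsprojK; rewrite [g _](canLR fK (hE u)) ?subvsP.
  have gU : g (vsval u) \in U' by rewrite -fU gK subvsP.
  by apply: val_inj; rewrite [LHS]hE /= vsprojK.
- move=> u v; apply: val_inj; rewrite [LHS]vE ?mulU ?subvsP //.
  by rewrite [RHS]vsprojK !hE -fM // fU mulU ?subvsP.
- by apply: val_inj; rewrite [LHS]vE // [RHS]vsprojK -f1 ?fU.
- move=> u; apply: val_inj; rewrite [LHS]vE ?starU ?subvsP //.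
  by rewrite [RHS]vsprojK hE -fS // fU starU ?subvsP.
- rewrite /= fbE -[LHS]imfset_comp -[RHS]imfset_comp; apply: eq_in_imfset => x xX.
  have xU : x \in U' by apply: memv_span.
  by apply: val_inj; rewrite [LHS]vE // [RHS]vsprojK // fU.
Qed.

(** * Primitive idempotents of the entrywise product *)

Section LinearExtension.
Variables (R : realType) (X : algData R).
Hypothesis basisX : basis_of fullv (basis X).

(** Stated for a bare function, since the products of an [algData] come with
    proofs of linearity but without a linear structure. *)
Lemma linear_comb (V : lmodType R[i]) (h : X -> V) (c : X -> R[i]) (s : seq X) :
  linear h -> h (\sum_(r <- s) c r *: r) = \sum_(r <- s) c r *: h r.
Proof.
move=> linh.
have h0 : h 0 = 0.
  have := linh 1 0 0; rewrite !scale1r addr0 => h00.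
  by apply: (addrI (h 0)); rewrite -h00 addr0.
by elim: s => [|r s IH]; rewrite ?big_nil // !big_cons linh IH.
Qed.

Lemma linear_basis_ext (V : lmodType R[i]) (h k : X -> V) :
  linear h -> linear k -> {in basis X, h =1 k} -> h =1 k.
Proof.
move=> linh link hk u; rewrite (coef_expand basisX u) !linear_comb //.
by apply: eq_big_seq => r rX; rewrite hk.
Qed.

End LinearExtension.

Lemma iso_primitive_idempotent (R : realType) (X Y : algData R)
    (f : {linear X -> Y}) (E : X) :
  bijective f -> (forall u v : X, f (amul u v) = amul (f u) (f v)) ->
  primitive_idempotent (f E) <-> primitive_idempotent E.
Proof.
move=> f_bij fM; have f_inj := bij_inj f_bij.
have f0 u : f u = 0 -> u = 0 by rewrite -(linear0 f) => /f_inj.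
have idem u : idempotent_elt (f u) <-> idempotent_elt u.
  by rewrite /idempotent_elt -fM; split=> [/f_inj|->].
have E0 : (f E != 0) = (E != 0) by rewrite -(inj_eq f_inj) linear0.
split=> -[nz iE prim]; rewrite ?E0 in nz.
  split=> //; first exact/idem.
  move=> F G /idem iF /idem iG FG GF EFG.
  have [] := prim (f F) (f G) iF iG.
  - by rewrite -fM FG linear0.
  - by rewrite -fM GF linear0.
  - by rewrite EFG linearD.
  - by move/f0; left.
  - by move/f0; right.
split; [by rewrite E0|exact/idem|].
move=> F G; elim/(iso_surj f_bij): F => F; elim/(iso_surj f_bij): G => G.
rewrite -!fM -linearD => /idem iF /idem iG /f0 FG /f0 GF /f_inj EFG.
by case: (prim F G iF iG FG GF EFG) => ->; rewrite linear0; [left|right].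
Qed.

Section Hadamard.
Variables (R : realType) (X : algData R).
Hypothesis basisX : basis_of fullv (basis X).

Lemma coef_dual_mul (u v t : X) : t \in basis X ->
  coef (amul (a := dual X) u v : X) t = coef u t * coef v t.
Proof. by move=> tX; rewrite coef_comb. Qed.

Lemma coef_dual_star (u t : X) : t \in basis X ->
  coef (astar (a := dual X) u : X) t = (coef u t)^*.
Proof. by move=> tX; rewrite coef_comb. Qed.

Lemma dual_basis_idempotent (t : X) :
  t \in basis X -> idempotent_elt (X := dual X) t.
Proof.
move=> tX; apply: (coef_inj basisX) => s sX; rewrite coef_dual_mul //.
by rewrite coef_basis // -natrM mulnb andbb.
Qed.

Lemma dual_idempotent_coef (F t : X) : t \in basis X ->
  idempotent_elt (X := dual X) F -> coef F t = 0 \/ coef F t = 1.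
Proof.
move=> tX /(congr1 (fun v : X => coef v t)); rewrite coef_dual_mul //.
move/eqP; rewrite -subr_eq0 -{3}[coef F t]mulr1 -mulrBr mulf_eq0 subr_eq0.
by case/orP => /eqP; [left|right].
Qed.

(** An idempotent of the entrywise product has coordinates 0 and 1; splitting off
    one basis element t where the coordinate is 1 decomposes it, so a primitive
    one equals t. *)
Lemma dual_primitive_idempotent (F : X) :
  primitive_idempotent (X := dual X) F <-> F \in basis X.
Proof.
split=> [[nz iF prim]|FX].
  have [t tX Ft] : exists2 t, t \in basis X & coef F t != 0.
    apply/hasP; apply: contraNT nz => /hasPn F0; apply/eqP.
    by apply: (coef_inj basisX) => t /F0; rewrite negbK coef0 => /eqP.
  have F1 : coef F t = 1.
    by have [F0|//] := dual_idempotent_coef tX iF; rewrite F0 eqxx in Ft.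
  have [||||//|t0|/eqP] := prim t (F - t : X); last 1 first.
  - by rewrite subr_eq0 => /eqP ->.
  - exact: dual_basis_idempotent.
  - apply: (coef_inj basisX) => s sX.
    rewrite coef_dual_mul // coefB (coef_basis basisX tX sX).
    case: (eqVneq t s) => [<-|_]; first by rewrite F1 mulr1n; ring.
    by rewrite mulr0n subr0; have [->|->] := dual_idempotent_coef sX iF; ring.
  - apply: (coef_inj basisX) => s sX.
    rewrite coef_dual_mul // coefB (coef_basis basisX tX sX) coef0.
    case: (eqVneq t s) => [<-|_]; first by rewrite F1 mulr1n; ring.
    by rewrite mulr0n; ring.
  - apply: (coef_inj basisX) => s sX.
    rewrite coef_dual_mul // coefB (coef_basis basisX tX sX) coef0.
    case: (eqVneq t s) => [<-|_]; first by rewrite F1 mulr1n; ring.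
    by rewrite mulr0n; ring.
  - by rewrite addrC subrK.
  by have := basis_neq0 basisX tX; rewrite t0 eqxx.
split; first exact: (basis_neq0 basisX FX).
  exact: dual_basis_idempotent.
move=> G H iG iH GH _ EGH.
have GH0 s : s \in basis X -> s != F -> coef (G : X) s = 0 /\ coef (H : X) s = 0.
  move=> sX sF; have := congr1 (fun v : X => coef v s) EGH.
  rewrite /= coefD coef_basis // eq_sym (negbTE sF) mulr0n.
  have [->|->] := dual_idempotent_coef sX iG;
  have [->|->] := dual_idempotent_coef sX iH => //.
  - by rewrite add0r => /eqP; rewrite eq_sym oner_eq0.
  - by rewrite addr0 => /eqP; rewrite eq_sym oner_eq0.
  - by move/eqP; rewrite eq_sym -[1 + 1]/(2%:R) pnatr_eq0.
have := congr1 (fun v : X => coef v F) GH; rewrite coef_dual_mul // coef0.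
move/eqP; rewrite mulf_eq0 => /orP[] /eqP F0; [left|right];
  apply: (coef_inj basisX) => s sX; rewrite coef0;
  by have [->//|/(GH0 s sX)[]] := eqVneq s F.
Qed.

End Hadamard.

(** * The character table as an isomorphism onto the dual *)

Section Eigenbasis.
Variables (R : realType) (X : algData R) (q : R[i]).
Let e := aone X.
Let J := \sum_(r <- basis X) r.
Let m : R[i] := (size (basis X)).-1%:R.
Let w := 1 + m * q.

(** In the algebras considered, n = w ^+ 2 and for r <> e this is n E, where E is
    the primitive idempotent on which r acts by q - w and every other nonidentity
    basis element by q; for r = e it is n times the idempotent of the degree. *)
Definition eigen (r : X) : X :=
  if r == e then J else w *: (q *: e - r) + q *: J.

Definition eigen_transform (u : X) : X :=
  \sum_(r <- basis X) coef u r *: eigen r.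

Lemma eigen_transform_is_linear : linear eigen_transform.
Proof.
move=> a u v; rewrite /eigen_transform scaler_sumr -big_split.
by apply: eq_bigr => r _; rewrite coef_linear scalerDl scalerA.
Qed.

HB.instance Definition _ :=
  GRing.isLinear.Build R[i] X X *:%R eigen_transform eigen_transform_is_linear.

(** The product formula is equivalent to
      (q e - r)(q e - s) = q^2 J + [r = s] (eigen r),
    that is, modulo J the elements r - q e are multiples of orthogonal
    idempotents. *)
Definition self_dual_at : Prop :=
  [/\ q \is Num.real,
      {in (basis X `\ e)%fset, forall r, degree r = 2 * q + m * q ^+ 2}
    & {in (basis X `\ e)%fset &, forall r s,
         amul r s = q *: (r + s) + q ^+ 2 *: (J - e)
                    + (r == s)%:R *: eigen r}].

Hypothesis CX : is_Calgebra X.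
Hypothesis star_id : {in basis X, forall r : X, astar r = r}.
Hypothesis self_dual_q : self_dual_at.

Let q_real : q \is Num.real. Proof. by case: self_dual_q. Qed.
Let degreeE :
  {in (basis X `\ e)%fset, forall r, degree r = 2 * q + m * q ^+ 2}.
Proof. by case: self_dual_q. Qed.
Let mulE : {in (basis X `\ e)%fset &, forall r s,
  amul r s = q *: (r + s) + q ^+ 2 *: (J - e) + (r == s)%:R *: eigen r}.
Proof. by case: self_dual_q. Qed.
Let basisX : basis_of fullv (basis X). Proof. by case: CX. Qed.
Let eX : e \in basis X. Proof. by case: CX => _ _ []. Qed.

Let mE : m = (size (basis X `\ e)%fset)%:R.
Proof. by rewrite /m [size _](cardfsD1 e) eX. Qed.

Lemma big_basis_one (V : nmodType) (F : X -> V) :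
  \sum_(r <- basis X) F r = F e + \sum_(r <- (basis X `\ e)%fset) F r.
Proof. exact: big_fsetD1. Qed.

Let sum_const (V : lmodType R[i]) (v : V) :
  \sum_(r <- (basis X `\ e)%fset) v = m *: v.
Proof. by rewrite big_const_seq count_predT iter_addr_0 mE scaler_nat. Qed.

Let sum_nonone : \sum_(r <- (basis X `\ e)%fset) r = J - e.
Proof. by rewrite /J big_basis_one addrAC subrr add0r. Qed.

Lemma degree_one : degree e = 1.
Proof.
case: CX => [[_ _ [mul1 _] _ _] _ _ _ _].
by rewrite /degree /sconst star_id // mul1 coef_basis // eqxx.
Qed.

Lemma total_degreeE : total_degree X = w ^+ 2.
Proof.
rewrite /total_degree big_basis_one degree_one.
rewrite (eq_big_seq (fun=> 2 * q + m * q ^+ 2)) => [|r rX]; last exact: degreeE.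
rewrite (sum_const (_ : R[i]^o)) /GRing.scale /= /w; ring.
Qed.

(** The sum of the degrees is positive and equals w ^+ 2. *)
Lemma w_neq0 : w != 0.
Proof.
have : 0 < total_degree X.
  rewrite /total_degree big_basis_one degree_one ltr_wpDr //.
  rewrite big_seq sumr_ge0 // => r; rewrite in_fsetD1 => /andP[_ rX].
  by case: CX => _ _ _ _ [[dpos _] _]; rewrite ltW // dpos.
by rewrite total_degreeE; apply: contraTneq => ->; rewrite expr0n ltxx.
Qed.

Lemma coef_eigen r t : r \in basis X -> t \in basis X ->
  coef (eigen r) t =
  if r == e then 1 else w * (q * (e == t)%:R - (r == t)%:R) + q.
Proof.
move=> rX tX; rewrite /eigen; case: (r == e); first exact: coef_one_basis_sum.
rewrite coefD !coefZ coef_one_basis_sum // coefB coefZ.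
by rewrite !coef_basis //; ring.
Qed.

Lemma eigen_transform_basis r : r \in basis X -> eigen_transform r = eigen r.
Proof.
move=> rX; rewrite /eigen_transform (bigD1_seq r) ?fset_uniq //=.
rewrite coef_basis // eqxx scale1r big1_seq ?addr0 // => s /andP[sr sX].
by rewrite coef_basis // eq_sym (negbTE sr) scale0r.
Qed.

Lemma eigen_transform_one : eigen_transform e = J.
Proof. by rewrite eigen_transform_basis // /eigen eqxx. Qed.

Lemma eigen_transform_J : eigen_transform J = w ^+ 2 *: e.
Proof.
rewrite linear_sum big_basis_one /= eigen_transform_one.
have -> : \sum_(r <- (basis X `\ e)%fset) eigen_transform r =
          w *: (m *: (q *: e) - (J - e)) + m *: (q *: J).
  rewrite (eq_big_seq (fun r => w *: (q *: e - r) + q *: J)) => [|r].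
    by rewrite big_split /= -scaler_sumr sumrB !sum_const sum_nonone.
  rewrite in_fsetD1 => /andP[re rX].
  by rewrite eigen_transform_basis // /eigen (negbTE re).
apply: (coef_inj basisX) => t tX.
rewrite !(coefD, coefN, coefZ) /w.
rewrite coef_one_basis_sum //; ring.
Qed.

(** The relation P^2 = n for the character table. *)
Lemma eigen_transformK u : eigen_transform (eigen_transform u) = w ^+ 2 *: u.
Proof.
apply: (linear_basis_ext basisX (h := eigen_transform \o eigen_transform)
         (k := *:%R (w ^+ 2))) => [a x y|a x y|r rX] /=.
- by rewrite !linearP.
- by rewrite scalerDr !scalerA mulrC.
rewrite (eigen_transform_basis rX) /eigen; case: eqVneq => [->|re].
  exact: eigen_transform_J.
rewrite linearD !linearZ linearB linearZ /= eigen_transform_one eigen_transform_J.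
rewrite (eigen_transform_basis rX) /eigen (negbTE re).
apply: (coef_inj basisX) => t tX.
rewrite !(coefD, coefN, coefZ); ring.
Qed.

Lemma eigen_transform_bij : bijective eigen_transform.
Proof.
have w2 : w ^+ 2 != 0 by rewrite expf_neq0 ?w_neq0.
exists (fun u => (w ^+ 2)^-1 *: eigen_transform u) => u.
  by rewrite eigen_transformK scalerA mulVf // scale1r.
by rewrite linearZ /= eigen_transformK scalerA mulVf // scale1r.
Qed.

Let basis_cases r : r \in basis X -> r = e \/ r \in (basis X `\ e)%fset.
Proof. by rewrite in_fsetD1 => ->; case: eqVneq; [left|right]. Qed.

Lemma eigen_transform_mul_basis r s t :
  r \in (basis X `\ e)%fset -> s \in (basis X `\ e)%fset -> t \in basis X ->
  coef (eigen_transform (amul r s)) t =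
  coef (eigen_transform r) t * coef (eigen_transform s) t.
Proof.
move=> r' s' tX; rewrite mulE //.
have /andP[re rX] : (r != e) && (r \in basis X) by rewrite -in_fsetD1.
have /andP[se sX] : (s != e) && (s \in basis X) by rewrite -in_fsetD1.
have eigE x : x \in basis X -> x != e -> eigen x = eigen_transform x.
  by move=> xX _; rewrite eigen_transform_basis.
rewrite eigE // !(linearD, linearN, linearZ) /= eigen_transformK.
rewrite eigen_transform_J eigen_transform_one !eigen_transform_basis //.
rewrite !(coefD, coefN, coefZ) !coef_eigen // coef_one_basis_sum //.
rewrite !coef_basis // (negbTE re) (negbTE se).
have [<-|et] := eqVneq e t; last first.
  rewrite !mulr0n; have [<-|rs] := eqVneq r s; last first.
    have [<-|rt] := eqVneq r t; first by rewrite eq_sym (negbTE rs) /=; ring.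
    by case: (s == t); rewrite /=; ring.
  by case: (r == t); rewrite /=; ring.
rewrite (negbTE re) (negbTE se); case: (r == s); rewrite /=; ring.
Qed.

(** The coordinate at t of the transform is a linear form in each argument, so
    multiplicativity need only be tested on basis elements: there it says that
    each row of the table is a character. *)
Lemma eigen_transform_mul u v :
  eigen_transform (amul u v) =
  amul (a := dual X) (eigen_transform u) (eigen_transform v).
Proof.
case: CX => [[[linl linr] _ [one_mul mul_one] _ _] _ _ _ _].
apply: (coef_inj basisX) => t tX; rewrite [RHS]coef_dual_mul //.
pose chi x := coef (eigen_transform x) t.
have chi_lin a x y : chi (a *: x + y) = a * chi x + chi y.
  by rewrite /chi linearP coef_linear.
suff chiM : chi \o amul^~ v =1 (fun x => chi x * chi v) by exact: (chiM u).
apply: (linear_basis_ext basisX (V := R[i]^o)) => [a x y|a x y|].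
- by rewrite /= linr chi_lin.
- by rewrite /= chi_lin mulrDl -mulrA.
move=> r rX.
suff chiM : chi \o amul r =1 (fun x => chi r * chi x) by exact: (chiM v).
apply: (linear_basis_ext basisX (V := R[i]^o)) => [a x y|a x y|].
- by rewrite /= linl chi_lin.
- by rewrite /= chi_lin mulrDr mulrCA.
move=> s sX; rewrite /= /chi.
have [->|r'] := basis_cases rX.
  by rewrite one_mul eigen_transform_one coef_one_basis_sum // mul1r.
have [->|s'] := basis_cases sX; last exact: eigen_transform_mul_basis.
by rewrite mul_one eigen_transform_one coef_one_basis_sum // mulr1.
Qed.

Lemma astar_comb (c : X -> R[i]) (s : seq X) :
  astar (\sum_(r <- s) c r *: r) = \sum_(r <- s) (c r)^* *: astar r.
Proof.
case: CX => [[_ _ _ [_ star_lin] _] _ _ _ _].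
have star0 : astar (0 : X) = 0.
  have := star_lin 1 0 0; rewrite scaler0 addr0 rmorph1 scale1r => st0.
  by apply: (addrI (astar (0 : X))); rewrite -st0 addr0.
by elim: s => [|r s IH]; rewrite ?big_nil // !big_cons star_lin IH.
Qed.

(** The star of X conjugates coordinates because it fixes the basis, and the
    table is real. *)
Lemma eigen_transform_star u :
  eigen_transform (astar u) = astar (a := dual X) (eigen_transform u).
Proof.
have coef_real r t : r \in basis X -> t \in basis X ->
    (coef (eigen r) t)^* = coef (eigen r) t.
  move=> rX tX; apply: conj_Creal; rewrite coef_eigen //; case: ifP => // _.
  have mR : m \is Num.real by rewrite realn.
  have wR : w \is Num.real by rewrite realD ?realM.
  by rewrite realD // realM // realB // ?realM // ?realn.
have starE : astar u = \sum_(r <- basis X) (coef u r)^* *: r.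
  rewrite {1}(coef_expand basisX u) astar_comb; apply: eq_big_seq => r rX.
  by rewrite star_id.
apply: (coef_inj basisX) => t tX; rewrite [RHS]coef_dual_star //.
rewrite starE linear_sum /eigen_transform !coef_sum rmorph_sum.
apply: eq_big_seq => r rX /=.
by rewrite linearZ /= eigen_transform_basis // !coefZ rmorphM /= coef_real.
Qed.

(** The transform carries primitive idempotents to primitive idempotents of the
    entrywise product, which are the basis elements; applying it again multiplies
    by n. *)
Lemma eigen_transform_dual_basis :
  [fset eigen_transform r | r in basis X]%fset = basis (dual X).
Proof.
rewrite -[LHS]cardinality.set_fsetK; congr cardinality.fset_set.
apply/classical_sets.seteqP; split=> x /=.
  case/imfsetP => r /= rX ->; exists ((w ^+ 2)^-1 *: eigen_transform r).
    apply/(iso_primitive_idempotent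
      (f := eigen_transform : {linear X -> dual X})).
    - exact: eigen_transform_bij.
    - exact: eigen_transform_mul.
    apply/dual_primitive_idempotent => //=.
    rewrite linearZ /= eigen_transformK scalerA mulVf ?scale1r //.
    by rewrite expf_neq0 ?w_neq0.
  by rewrite total_degreeE scalerA mulfV ?scale1r // expf_neq0 ?w_neq0.
case=> E primE ->; apply/imfsetP; exists (eigen_transform E) => /=.
  apply/(dual_primitive_idempotent basisX).
  apply/(iso_primitive_idempotent
    (f := eigen_transform : {linear X -> dual X})) => //.
    exact: eigen_transform_bij.
  exact: eigen_transform_mul.
by rewrite eigen_transformK total_degreeE.
Qed.

Lemma isomorphic_eigen_dual : isomorphic X (dual X).
Proof.
exists (eigen_transform : {linear X -> dual X}); split.
- exact: eigen_transform_bij.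
- exact: eigen_transform_mul.
- exact: eigen_transform_one.
- exact: eigen_transform_star.
- exact: eigen_transform_dual_basis.
Qed.

End Eigenbasis.

(** * Structure constants of amorphic algebras *)

Section AmorphicConstants.
Variables (R : realType) (X : algData R).
Hypotheses (CX : is_Calgebra X) (amoX : amorphic X).
Implicit Types r s t : X.

Let basisX : basis_of fullv (basis X). Proof. by case: CX. Qed.
Let oneX : aone X \in basis X. Proof. by case: CX => _ _ []. Qed.

(** Fuse the basis elements outside S into one class and keep those of S apart.
    The coordinates of an element of the fusion space are constant on classes. *)
Lemma amorphic_subalgebra (S : seq X) : aone X \in S ->
  exists U : {vspace X}, [/\ is_star_subalgebra U,
    {in basis X, forall s, s \in S -> s \in U}
  & {in U, forall v, {in basis X &, forall t t', t \notin S -> t' \notin S ->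
      coef v t = coef v t'}}].
Proof.
move=> oneS.
(* The classes are the fibres of label. *)
pose label (x : basis X) := if val x \in S then Some x else None.
pose pi := preim_partition label setT.
have piP (B : {set basis X}) :
    reflect (exists x, B = [set y | label x == label y]) (B \in pi).
  apply: (iffP imsetP) => [[x _ ->]|[x ->]]; exists x => //;
  by apply/setP => y; rewrite !inE.
have pi1 (x : basis X) : val x \in S -> [set x] \in pi.
  move=> xS; apply/piP; exists x; apply/setP => y; rewrite !inE /label xS.
  case: ifP => [_|yS]; first by rewrite eq_sym.
  by rewrite -val_eqE; apply: contraFF yS => /eqP ->.
have [|subU _] := amoX (preim_partitionP label setT).
  rewrite (_ : [set r | _] = [set [` oneX]%fset]); first exact: pi1.
  by apply/setP => x; rewrite !inE -val_eqE.
exists (fusion_space pi); split=> // [s sX sS|v vU t t' tX t'X tS t'S].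
  apply/memv_span/imfsetP; exists [set [` sX]%fset] => /=; first exact: pi1.
  by rewrite big_set1.
have dcoef_lin : linear (fun v => coef v t - coef v t' : R[i]^o).
  by move=> a u w; rewrite !coef_linear scalerBr opprD addrACA.
pose dcoef : {linear X -> R[i]^o} :=
  HB.pack (fun v => coef v t - coef v t' : R[i]^o)
    (GRing.isLinear.Build _ _ _ _ _ dcoef_lin).
suff /subvP/(_ v vU) : (fusion_space pi <= lker (linfun dcoef))%VS.
  by rewrite memv_ker lfunE /= subr_eq0 => /eqP.
apply/span_subvP => _ /imfsetP[B /= /piP[x ->] ->].
rewrite memv_ker (lfunE dcoef) /= subr_eq0 !coef_sum.
have coef_block z (zX : z \in basis X) : z \notin S ->
    \sum_(y in [set y | label x == label y]) coef (val y) z = (label x == None)%:R.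
  move=> zS; rewrite (eq_bigr (fun y => (y == [` zX]%fset)%:R)) => [|y _].
    have [xN|xN] := eqVneq (label x) None.
      rewrite (bigD1 [` zX]%fset) /=; last by rewrite inE xN /label /= (negbTE zS).
      by rewrite eqxx big1 ?addr0 // => y /andP[_ /negbTE ->].
    rewrite big1 // => y; rewrite inE => /eqP xy; case: eqVneq => // yz.
    by rewrite xy yz /label /= (negbTE zS) in xN.
  by rewrite coef_basis //; apply: valP.
by rewrite !coef_block.
Qed.

Lemma amorphic_sconst r s t t' : r \in basis X -> s \in basis X ->
  t \in basis X -> t' \in basis X ->
  t \notin [:: aone X; r; s] -> t' \notin [:: aone X; r; s] ->
  sconst r s t = sconst r s t'.
Proof.
move=> rX sX tX t'X tN t'N.
have [|U [[_ mulU _] SU UE]] := @amorphic_subalgebra [:: aone X; r; s].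
  by rewrite mem_head.
apply: UE => //.
by apply: mulU; apply: SU; rewrite // !inE eqxx ?orbT.
Qed.

(** If r is not fixed, the fusion that isolates e and r contains the basis element
    astar r, whose coordinates are constant off {e, r}; so there is nothing else
    off {e, r}, and the rank is 3. *)
Lemma amorphic_star : size (basis X) <> 3 ->
  {in basis X, forall r, astar r = r}.
Proof.
case: CX => [[_ _ [_ mulr1] [starK _] starM] _ [_ starX] _ _].
have star1 : astar (aone X) = aone X.
  by have := starM (astar (aone X)) (aone X); rewrite starK !mulr1 starK => /esym.
move=> size3 r rX; apply/eqP; apply: contra_notT size3 => r'r.
have r1 : r != aone X by apply: contraNneq r'r => ->; rewrite star1.
have r'1 : astar r != aone X by rewrite -star1 (can_eq starK).
have [|U [[_ _ starU] SU UE]] := @amorphic_subalgebra [:: aone X; r].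
  by rewrite mem_head.
have rU : astar r \in U by apply/starU/SU; rewrite // !inE eqxx orbT.
have sub3 : {subset basis X <= [:: aone X; r; astar r]}.
  move=> t tX; apply: contraT; rewrite !inE !negb_or => /and3P[t1 tr tr'].
  have := UE _ rU t (astar r) tX (starX r rX).
  rewrite !inE !negb_or t1 tr r'1 r'r => /(_ isT isT).
  rewrite !coef_basis ?starX // eqxx eq_sym (negbTE tr') => /esym/eqP.
  by rewrite oner_eq0.
apply/eqP; rewrite eqn_leq (uniq_leq_size (fset_uniq _) sub3) /=.
apply: (@uniq_leq_size _ [:: aone X; r; astar r]).
  by rewrite /= !inE negb_or eq_sym r1 eq_sym r'1 eq_sym r'r.
by move=> x; rewrite !inE => /or3P[]/eqP->; rewrite ?starX.
Qed.

End AmorphicConstants.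

(** * Symmetric algebras: cyclic symmetry and degree counts *)

Section SymmetricConstants.
Variables (R : realType) (X : algData R).
Hypothesis CX : is_Calgebra X.
Hypothesis star_id : {in basis X, forall r : X, astar r = r}.
Implicit Types r s t : X.
Let e := aone X.
Let J := \sum_(r <- basis X) r.

Let basisX : basis_of fullv (basis X). Proof. by case: CX. Qed.
Let eX : e \in basis X. Proof. by case: CX => _ _ []. Qed.

Lemma sconst_e r s : r \in basis X -> s \in basis X ->
  sconst r s e = degree r * (r == s)%:R.
Proof. by case: CX => _ _ _ _ [[_ c3] _] rX sX; rewrite c3 // star_id. Qed.

Lemma degree_gt0 r : r \in basis X -> 0 < degree r.
Proof. by case: CX => _ _ _ _ [[dpos _] _]; apply: dpos. Qed.

Lemma degree_neq0 r : r \in basis X -> degree r != 0.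
Proof. by move=> rX; rewrite gt_eqF // degree_gt0. Qed.

(** Both sides are the coefficient of e in r s t. *)
Lemma sconst_cyclic r s t :
  r \in basis X -> s \in basis X -> t \in basis X ->
  degree t * sconst r s t = degree r * sconst s t r.
Proof.
case: CX => [[[linl linr] mulA _ _ _] _ _ _ _] rX sX tX.
have := congr1 (fun v : X => coef v e) (mulA r s t) => /=.
rewrite {1}(coef_expand basisX (amul s t)) (coef_expand basisX (amul r s)).
rewrite (linear_comb _ _ (linl r)) (linear_comb _ _ (linr t)) !coef_sum.
rewrite (bigD1_seq r) ?fset_uniq //= big1_seq => [|u /andP[ur uX]]; last first.
  by rewrite coefZ -/(sconst r u e) sconst_e // eq_sym (negbTE ur) !mulr0.
rewrite (bigD1_seq t) ?fset_uniq //= [X in _ = _ + X]big1_seq; last first.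
  move=> u /andP[ut uX].
  by rewrite coefZ -/(sconst u t e) sconst_e // (negbTE ut) !mulr0.
rewrite !coefZ -/(sconst r r e) -/(sconst t t e) !sconst_e //.
by rewrite !eqxx !addr0 !mulr1 ![degree _ * _]mulrC => ->.
Qed.

(** The degree map is multiplicative. *)
Lemma sconst_sum_degree r s : r \in basis X -> s \in basis X ->
  \sum_(t <- basis X) sconst r s t * degree t = degree r * degree s.
Proof.
case: CX => _ _ _ _ [_ [_ dM _]] rX sX; have := dM r s.
have dE u : u \in basis X -> degree_fun u = degree u.
  move=> uX; rewrite /degree_fun (bigD1_seq u) ?fset_uniq //= coef_basis // eqxx.
  rewrite mul1r big1_seq ?addr0 // => t /andP[tu tX].
  by rewrite coef_basis // eq_sym (negbTE tu) mul0r.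
by rewrite (dE r) // (dE s).
Qed.

(** The star reverses products and fixes the basis, and the structure constants
    are real. *)
Lemma amul_sym r s : r \in basis X -> s \in basis X -> amul r s = amul s r.
Proof.
case: CX => [[_ _ _ _ starM] _ _ c2 _] rX sX.
have := starM r s; rewrite (star_id rX) (star_id sX) => <-.
rewrite {2}(coef_expand basisX (amul r s)) (astar_comb CX).
rewrite {1}(coef_expand basisX (amul r s)); apply: eq_big_seq => t tX.
by rewrite star_id // conj_Creal //; apply: c2.
Qed.

Lemma amul_basis_sum s : s \in basis X -> amul J s = degree s *: J.
Proof.
move=> sX; case: CX => [[[_ linr] _ _ _ _] _ _ _ _].
apply: (coef_inj basisX) => t tX; rewrite coefZ coef_one_basis_sum // mulr1.
have -> : amul J s = \sum_(r <- basis X) 1 *: amul r s.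
  rewrite -(linear_comb _ _ (linr s)); congr amul.
  by apply: eq_bigr => r _; rewrite scale1r.
apply: (mulfI (degree_neq0 tX)).
rewrite coef_sum mulr_sumr [RHS]mulrC -sconst_sum_degree //.
apply: eq_big_seq => r rX.
by rewrite scale1r [LHS]sconst_cyclic // mulrC.
Qed.

Lemma amul_basis_sumr s : s \in basis X -> amul s J = degree s *: J.
Proof.
move=> sX; rewrite -amul_basis_sum //; case: CX => [[[linl linr] _ _ _ _] _ _ _ _].
have J1 : J = \sum_(r <- basis X) 1 *: r by apply: eq_bigr => r _; rewrite scale1r.
rewrite J1 (linear_comb _ _ (linl s)) (linear_comb _ _ (linr s)).
by apply: eq_big_seq => r rX; rewrite amul_sym.
Qed.

End SymmetricConstants.

(** * The homogeneous case of rank at least 4 *)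

Section HomogeneousAmorphic.
Variables (R : realType) (X : algData R).
Hypotheses (CX : is_Calgebra X) (amoX : amorphic X) (homX : homogeneous X).
Hypothesis size4 : (4 <= size (basis X))%N.
Implicit Types r s t : X.
Let e := aone X.
Let J := \sum_(r <- basis X) r.
Let m : R[i] := (size (basis X)).-1%:R.
Let T := (basis X `\ e)%fset.

Let basisX : basis_of fullv (basis X). Proof. by case: CX. Qed.
Let eX : e \in basis X. Proof. by case: CX => _ _ []. Qed.
Let star_id : {in basis X, forall r : X, astar r = r}.
Proof. by apply: amorphic_star => // size3; have := size4; rewrite size3. Qed.
Let TX r : r \in T -> r \in basis X. Proof. by rewrite in_fsetD1 => /andP[]. Qed.
Let Te r : r \in T -> r != e. Proof. by rewrite in_fsetD1 => /andP[]. Qed.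

Let sizeT : size T = (size (basis X)).-1.
Proof. by rewrite [in RHS](cardfsD1 e) eX. Qed.

Let sconst_eq r s t t' : r \in T -> s \in T -> t \in T -> t' \in T ->
  t \notin [:: r; s] -> t' \notin [:: r; s] -> sconst r s t = sconst r s t'.
Proof.
move=> rT sT tT t'T trs t'rs; apply: amorphic_sconst => //; try exact: TX.
  by rewrite inE negb_or Te.
by rewrite inE negb_or Te.
Qed.

Let sconst_rot r s t : r \in T -> s \in T -> t \in T ->
  sconst r s t = sconst s t r.
Proof.
move=> rT sT tT; apply: (mulfI (degree_neq0 CX (TX rT))).
by rewrite -sconst_cyclic ?TX //; congr (_ * _); apply: homX.
Qed.

Let sconst_swap r s t : r \in T -> s \in T -> sconst r s t = sconst s r t.
Proof. by move=> rT sT; rewrite /sconst amul_sym ?TX. Qed.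

Let sconst_sum r s : r \in T -> s \in T ->
  (r == s)%:R + \sum_(t <- T) sconst r s t = degree r.
Proof.
move=> rT sT; have rX := TX rT; have sX := TX sT.
apply: (mulfI (degree_neq0 CX rX)).
rewrite [X in _ = _ * X](homX rT sT) -sconst_sum_degree // [RHS](big_fsetD1 e) //=.
rewrite sconst_e // degree_one // mulr1 mulrDr mulr_sumr; congr (_ + _).
by apply: eq_big_seq => t tT; rewrite mulrC (homX rT tT).
Qed.

Let sum_split2 r s (F : X -> R[i]) (c : R[i]) : r \in T -> s \in T -> r != s ->
  {in T, forall t, t \notin [:: r; s] -> F t = c} ->
  \sum_(t <- T) F t = F r + F s + (m - 2) * c.
Proof.
move=> rT sT rs Fc; have sTr : s \in (T `\ r)%fset by rewrite in_fsetD1 eq_sym rs.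
rewrite (big_fsetD1 r) //= (big_fsetD1 s) //= addrA; congr (_ + _).
rewrite (eq_big_seq (fun=> c)) => [|t]; last first.
  rewrite in_fsetD1 => /andP[ts]; rewrite in_fsetD1 => /andP[tr tT].
  by apply: Fc; rewrite // !inE negb_or tr.
rewrite big_const_seq count_predT iter_addr_0 -[LHS]mulr_natl; congr (_ * _).
have := sizeT; rewrite /m => <-; rewrite [in RHS](cardfsD1 r) rT (cardfsD1 s) sTr.
by rewrite !natrD ?mulr1n; ring.
Qed.

Let sum_split1 r (F : X -> R[i]) (c : R[i]) : r \in T ->
  {in T, forall t, t != r -> F t = c} ->
  \sum_(t <- T) F t = F r + (m - 1) * c.
Proof.
move=> rT Fc; rewrite (big_fsetD1 r) //=; congr (_ + _).
rewrite (eq_big_seq (fun=> c)) => [|t]; last first.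
  by rewrite in_fsetD1 => /andP[tr tT]; apply: Fc.
rewrite big_const_seq count_predT iter_addr_0 -[LHS]mulr_natl; congr (_ * _).
have := sizeT; rewrite /m => <-; rewrite [in RHS](cardfsD1 r) rT.
by rewrite !natrD ?mulr1n; ring.
Qed.

Let sum_distinct r s t : r \in T -> s \in T -> t \in T -> uniq [:: r; s; t] ->
  sconst r r s + sconst s s r + (m - 2) * sconst r s t = degree r.
Proof.
move=> rT sT tT; rewrite /= !inE negb_or andbT => /andP[/andP[rs rt] st].
rewrite -(sconst_sum rT sT) (negbTE rs) add0r.
rewrite (@sum_split2 r s _ (sconst r s t)) // => [|u uT urs]; last first.
  by apply: sconst_eq; rewrite // !inE negb_or ![t == _]eq_sym rt st.
congr (_ + _ + _); first by rewrite [RHS]sconst_swap // -sconst_rot.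
by rewrite [RHS]sconst_rot.
Qed.

(** The degree count for a triple of distinct r, s, t, compared with that for
    r, t, s, shows that the constants c_{ss}^r do not depend on s; the count then
    fixes all the constants c_{rs}^t.  The parameter is q = a - p. *)
Lemma homogeneous_amorphic_self_dual : exists q, self_dual_at X q.
Proof.
have [r0 [s0 [t0 [r0T s0T t0T u0]]]] : exists r0 s0 t0,
    [/\ r0 \in T, s0 \in T, t0 \in T & uniq [:: r0; s0; t0]].
  have : (2 < size T)%N by rewrite sizeT -ltnS prednK ?(leq_trans _ size4).
  have := fset_uniq T; have inT x : x \in enum_fset T -> x \in T by [].
  case: (enum_fset T) inT => [|x [|y [|z l]]] //= inT uxyz _; exists x, y, z.
  split; try by apply: inT; rewrite !inE eqxx ?orbT.
  move: uxyz; rewrite /= !inE !negb_or -!andbA.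
  by case/and5P=> -> -> _ -> _.
pose d := degree r0; pose a := sconst r0 r0 s0; pose p := sconst r0 s0 t0.
have dE r : r \in T -> degree r = d by move=> rT; apply: homX.
have sq_eq r s t : r \in T -> s \in T -> t \in T -> s != r -> t != r ->
    sconst r r s = sconst r r t.
  by move=> rT sT tT sr tr; apply: sconst_eq; rewrite // !inE orbb.
have sq_distinct r s t : r \in T -> s \in T -> t \in T -> uniq [:: r; s; t] ->
    sconst s s r = sconst t t r.
  move=> rT sT tT rst; move: (rst); rewrite /= !inE negb_or andbT.
  case/andP=> /andP[rs rt] st.
  have rts : uniq [:: r; t; s] by rewrite /= !inE negb_or rt rs eq_sym st.
  have := sum_distinct rT sT tT rst; rewrite -(sum_distinct rT tT sT rts).
  have -> : sconst r t s = sconst r s t by rewrite sconst_swap // sconst_rot.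
  by rewrite (sq_eq r s t) 1?eq_sym // -!addrA => /addrI/addIr.
have aE r s : r \in T -> s \in T -> s != r -> sconst r r s = a.
  move=> rT sT sr; have [rr0|rr0] := eqVneq r r0.
    rewrite rr0 in sr *; apply: sq_eq => //.
    by move: u0; rewrite /= !inE negb_or eq_sym => /andP[/andP[]].
  have [u [uT ur ur0]] : exists u, [/\ u \in T, u != r & u != r0].
    move: u0; rewrite /= !inE negb_or andbT => /andP[/andP[rs0 rt0] st0].
    have [rs|rs] := eqVneq r s0; [exists t0|exists s0]; split=> //.
    - by rewrite rs eq_sym.
    - by rewrite eq_sym.
    - by rewrite eq_sym.
    - by rewrite eq_sym.
  rewrite (sq_eq r s u) // (sq_distinct u r r0) //=; last first.
    by rewrite !inE negb_or ur ur0 rr0.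
  apply: sq_eq => //.
  by move: u0; rewrite /= !inE negb_or eq_sym => /andP[/andP[]].
(* Dividing by m - 2 is possible since the rank is at least 4. *)
have m2 : m - 2 != 0.
  rewrite /m -(natrB _ (_ : 2 <= _)%N) ?pnatr_eq0 ?subn_eq0 -?ltnNge;
  by case: (size (basis X)) size4 => [|[|[|[]]]].
have dap : d = 2 * a + (m - 2) * p.
  rewrite /d -(sum_distinct r0T s0T t0T u0) (aE s0 r0) //.
    by rewrite /a /p; ring.
  by move: u0; rewrite /= !inE negb_or => /andP[/andP[]].
have pE r s t : r \in T -> s \in T -> t \in T -> uniq [:: r; s; t] ->
    sconst r s t = p.
  move=> rT sT tT rst; have := sum_distinct rT sT tT rst.
  move: rst; rewrite /= !inE negb_or => /andP[/andP[rs _] _].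
  rewrite !aE // 1?eq_sym // (dE r) // => d_rst.
  by apply: (mulfI m2); apply: (addrI (2 * a)); rewrite -dap -d_rst; ring.
pose b := d - 1 - (m - 1) * a.
have bE r : r \in T -> sconst r r r = b.
  move=> rT; have := sconst_sum rT rT; rewrite eqxx mulr1n dE // /b => <-.
  by rewrite (@sum_split1 r _ a) // => [|t tT tr]; [ring|apply: aE].
have coefJ t : t \in basis X -> coef J t = 1 := @coef_one_basis_sum _ _ basisX t.
have T_cases t : t \in basis X -> t = e \/ t \in T.
  by rewrite in_fsetD1 => ->; case: eqVneq; [left|right].
have mulrr r : r \in T -> amul r r = d *: e + b *: r + a *: (J - e - r).
  move=> rT; apply: (coef_inj basisX) => t tX.
  rewrite !(coefD, coefN, coefZ) coefJ // (coef_basis basisX eX tX).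
  rewrite (coef_basis basisX (TX rT) tX).
  have [->|tT] := T_cases t tX.
    rewrite [LHS]sconst_e ?TX // eqxx dE // eqxx (negbTE (Te rT)).
    by rewrite mulr1n mulr0n; ring.
  rewrite ![e == t]eq_sym (negbTE (Te tT)) -[LHS]/(sconst r r t).
  case: (eqVneq r t) => [<-|rt]; first by rewrite bE //= ?mulr1n ?mulr0n; ring.
  by rewrite aE // 1?eq_sym //= ?mulr1n ?mulr0n; ring.
have mulrs r s : r \in T -> s \in T -> r != s ->
    amul r s = a *: (r + s) + p *: (J - e - r - s).
  move=> rT sT rs; apply: (coef_inj basisX) => t tX.
  rewrite !(coefD, coefN, coefZ) coefJ // (coef_basis basisX eX tX).
  rewrite (coef_basis basisX (TX rT) tX) (coef_basis basisX (TX sT) tX).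
  have [->|tT] := T_cases t tX.
    rewrite [LHS]sconst_e ?TX // eqxx (negbTE rs).
    by rewrite (negbTE (Te rT)) (negbTE (Te sT)) /= ?mulr1n ?mulr0n; ring.
  rewrite ![e == t]eq_sym (negbTE (Te tT)) -[LHS]/(sconst r s t).
  case: (eqVneq r t) => [<-|rt].
    rewrite eq_sym (negbTE rs) sconst_rot // sconst_rot // aE // 1?eq_sym //.
    by rewrite ?mulr1n ?mulr0n; ring.
  case: (eqVneq s t) => [<-|st].
    by rewrite sconst_rot // aE // ?mulr1n ?mulr0n; ring.
  by rewrite pE //= ?inE ?negb_or ?rs ?rt ?st //; ring.
(* Expand r0 (r0 s0) = (r0 r0) s0 and subtract the coefficient at t0 from the one
   at r0: the multiples of J cancel. *)
have pq : p = (a - p) ^+ 2.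
  case: CX => [[[linl linr] mulA [mul1 mulr1] _ _] _ _ _ _].
  pose Ls : {linear X -> X} :=
    HB.pack (amul^~ s0) (GRing.isLinear.Build _ _ _ _ _ (linr s0)).
  pose Lr : {linear X -> X} :=
    HB.pack (amul r0) (GRing.isLinear.Build _ _ _ _ _ (linl r0)).
  have LsE x : amul x s0 = Ls x by [].
  have LrE x : amul r0 x = Lr x by [].
  have /and3P[rs rt st] : [&& r0 != s0, r0 != t0 & s0 != t0].
    by move: u0; rewrite /= !inE negb_or andbT -andbA.
  have rJ : amul r0 J = d *: J by apply: amul_basis_sumr; rewrite ?TX.
  have := mulA r0 r0 s0.
  rewrite (mulrr r0) // [in LHS](mulrs r0 s0) // LsE LrE.
  rewrite !(linearD, linearN, linearZ) /= !mul1 mulr1 rJ.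
  rewrite (amul_basis_sum CX star_id (TX s0T)) (dE s0) //.
  rewrite (mulrr r0) // (mulrs r0 s0) // => assoc.
  have er : (e == r0) = false by rewrite eq_sym (negbTE (Te r0T)).
  have et : (e == t0) = false by rewrite eq_sym (negbTE (Te t0T)).
  have sr : (s0 == r0) = false by rewrite eq_sym (negbTE rs).
  have [[r0X s0X] t0X] := (TX r0T, TX s0T, TX t0T).
  have := congr1 (fun v : X => coef v r0 - coef v t0) assoc => /=.
  rewrite !(coefD, coefN, coefZ) !coefJ ?TX // -/e.
  rewrite !coef_basis // eqxx er et sr (negbTE rt) (negbTE st).
  rewrite ?mulr1n ?mulr0n => /eqP; rewrite -subr_eq0 => /eqP coefs.
  by apply/esym/eqP; rewrite -subr_eq0 -[X in _ == X]coefs; apply/eqP; ring.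
have [q [q_eq pq' aq]] : exists q, [/\ q = a - p, p = q ^+ 2 & a = q + q ^+ 2].
  by exists (a - p); split; rewrite // -pq subrK.
have dq : d = 2 * q + m * q ^+ 2 by rewrite dap aq pq'; ring.
exists q; split.
- case: CX => _ _ _ c2 _.
  by rewrite q_eq realB //; apply: c2; apply: TX.
- by move=> r rT; rewrite dE.
- move=> r s rT sT; apply: (coef_inj basisX) => t tX.
  have [<-|rs] := eqVneq r s; last first.
    rewrite mulr0n scale0r addr0 mulrs // !(coefD, coefN, coefZ) -/J coefJ //.
    by rewrite aq pq'; ring.
  rewrite mulrr // mulr1n scale1r !(coefD, coefN, coefZ) -/J coefJ //.
  rewrite (coef_eigen _ CX (TX rT) tX) (negbTE (Te rT)) -/e -/m.
  rewrite -(coef_basis basisX eX tX) -(coef_basis basisX (TX rT) tX) /b.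
  by rewrite dq aq; ring.
Qed.

End HomogeneousAmorphic.

(** * Ranks 1 and 2 *)

Section SmallRank.
Variables (R : realType) (X : algData R).
Hypothesis CX : is_Calgebra X.
Hypothesis star_id : {in basis X, forall r : X, astar r = r}.
Let e := aone X.
Let basisX : basis_of fullv (basis X). Proof. by case: CX. Qed.
Let eX : e \in basis X. Proof. by case: CX => _ _ []. Qed.

(** In rank 2, r r = d e + (d - 1) r with n = 1 + d, and n = (1 + q)^2 forces the
    choice of q; in rank 1 any real q will do. *)
Lemma rank_le2_self_dual : (size (basis X) <= 2)%N -> exists q, self_dual_at X q.
Proof.
have sizeX : size (basis X) = (size (basis X `\ e)%fset).+1.
  by rewrite [LHS](cardfsD1 e) eX.
rewrite sizeX ltnS leq_eqVlt ltnS leqn0.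
case/orP=> [/cardfs1P[r Tr]|/eqP/cardfs0_eq T0]; last first.
  exists 0; split; first exact: real0.
    by rewrite T0 => r; rewrite in_fset0.
  by rewrite T0 => r s; rewrite in_fset0.
have rT : r \in (basis X `\ e)%fset by rewrite Tr in_fset1.
have /andP[re rX] : (r != e) && (r \in basis X) by rewrite -in_fsetD1.
have m1 : (size (basis X)).-1 = 1%N by rewrite sizeX Tr [LHS]cardfs1.
set d := degree r.
have [q [qR qd]] : exists q, q \is Num.real /\ (1 + q) ^+ 2 = 1 + d.
  exists (sqrtC (1 + d) - 1); rewrite [1 + (_ - 1)]addrC subrK sqrtCK; split=> //.
  by rewrite realB // ger0_real // sqrtC_ge0 addr_ge0 // ltW // degree_gt0.
have dq : d = 2 * q + q ^+ 2 by apply: (addrI 1); rewrite -qd; ring.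
have rrr : sconst r r r = d - 1.
  have d0 : d != 0 by apply: degree_neq0.
  have := sconst_sum_degree CX rX rX; rewrite big_basis_one // Tr big_seq_fset1.
  rewrite sconst_e // degree_one // eqxx !mulr1 -/d => dd.
  by apply: (mulIf d0); rewrite mulrBl -dd; ring.
exists q; split=> //; rewrite Tr.
  by move=> s; rewrite in_fset1 m1 => /eqP ->; rewrite mul1r.
move=> r1 r2; rewrite !in_fset1 => /eqP -> /eqP ->.
apply: (coef_inj basisX) => t tX; rewrite eqxx mulr1n scale1r.
rewrite !(coefD, coefN, coefZ) (coef_eigen _ CX rX tX) m1.
rewrite (coef_one_basis_sum basisX tX).
rewrite (coef_basis basisX rX tX) (coef_basis basisX eX tX).
rewrite (negbTE re) -[LHS]/(sconst r r t) -/e.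
have [->|te] := eqVneq t e.
  by rewrite sconst_e // eqxx -/d (negbTE re) ?mulr1n ?mulr0n dq; ring.
have -> : t = r by apply/eqP; rewrite -in_fset1 -Tr in_fsetD1 te.
by rewrite eqxx rrr ?mulr1n ?mulr0n dq; ring.
Qed.

End SmallRank.

(** * Self-duality *)

Theorem theorem4p4 (R : realType) (X : algData R)
    (Xtable : is_table_algebra X) (Xhom : homogeneous X) (Xamo : amorphic X)
    (Xrank : size (basis X) <> 3) :
  [/\ is_table_algebra (dual X), homogeneous (dual X) & amorphic (dual X)] /\
  (forall (eps : R) (nu : nat) (d : R),
     in_Aeps_class eps nu d X -> in_Aeps_class eps nu d (dual X)) /\
  isomorphic X (dual X).
Proof.
have [CX _] := Xtable; have [_ basisX _ _ _] := CX.
have star_id := amorphic_star CX Xamo Xrank.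
have [q self_dual_q] : exists q, self_dual_at X q.
  have [size2|size2] := leqP (size (basis X)) 2.
    exact: rank_le2_self_dual.
  apply: homogeneous_amorphic_self_dual => //.
  by rewrite ltn_neqAle size2 andbT eq_sym; apply/eqP.
have Xdual : isomorphic X (dual X) := isomorphic_eigen_dual CX star_id self_dual_q.
have [f [f_bij fM f1 fS fB]] := Xdual.
have dual_table : is_table_algebra (dual X) by apply: (iso_table_algebra f_bij).
split; [split=> //|split=> // eps nu d].
- exact: (iso_homogeneous f_bij).
- exact: iso_amorphic Xdual Xamo.
case=> eps1 [d0 [I [e [dg [cardI labI _ XA]]]]].
split=> //; split=> //; exists I, e, dg; split=> //; first by case: dual_table.
exact: isomorphic_trans (isomorphic_sym Xdual) XA.
Qed.
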